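(* Let $A$ be a (unital, associative, complex) $*$-algebra whose first and second Hochschild cohomologies with coefficients in $A$ vanish, $H^1(A,A)=H^2(A,A)=0$. Then $A$ is rigid as $*$-algebra; that is, for every $\hbar$-adic $*$-algebra $A'$ which is a deformation of the $*$-algebra $A$, the $\hbar$-adic completion $A[[\hbar]]$ (with the $*$-structure extended order by order in $\hbar$) and $A'$ are isomorphic as $*$-algebras.
   Context: A $*$-algebra is a complex algebra with a $*$-structure, i.e. a conjugate-linear algebra antihomomorphism $*$ with $*^2=\mathrm{id}$. $\hbar$ is a formal parameter; $A[[\hbar]]$ is the algebra of formal power series in $\hbar$ with coefficients in $A$. An $\hbar$-adic algebra is an algebra over $\mathbb{C}[[\hbar]]$ that is topologically free as a $\mathbb{C}[[\hbar]]$-module (i.e. isomorphic as a module to $V[[\hbar]]$ for a complex vector space $V$). An $\hbar$-adic $*$-algebra is an $\hbar$-adic algebra with an involutive antihomomorphism that is conjugate linear over $\mathbb{C}[[\hbar]]$, where conjugation on $\mathbb{C}[[\hbar]]$ acts on coefficients and fixes $\hbar$. An $\hbar$-adic $*$-algebra $A'$ is called a deformation of the $*$-algebra $A$ if $A'/\hbar A'$ and $A$ are isomorphic as $*$-algebras. Isomorphisms of $\hbar$-adic $*$-algebras are $\mathbb{C}[[\hbar]]$-linear algebra isomorphisms intertwining the $*$-structures. $H^n(A,A)$ is the Hochschild cohomology of the complex algebra $A$. *)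

(* Defs.v *)
From HB Require Import structures.
From mathcomp Require Import all_boot all_order all_algebra.
From mathcomp Require Import generic_quotient ring_quotient.
From mathcomp Require Import boolp reals complex.

Set Implicit Arguments.
Unset Strict Implicit.
Unset Printing Implicit Defensive.

Import Order.TTheory GRing.Theory Num.Theory.
Local Open Scope ring_scope.
Local Open Scope quotient_scope.

(** ** Unital associative algebras *)

(* The algebra structures of the library exclude the zero algebra, and do not
   allow a common weakening of them to be inserted in their hierarchy; hence
   this separate bundle, which allows the zero algebra. *)
Record pzAlgType (K : pzRingType) := PzAlg {
  palg_ring : pzRingType;
  palg_scale : K -> palg_ring -> palg_ring;
  palg_scaleA : forall a b x,
    palg_scale a (palg_scale b x) = palg_scale (a * b) x;
  palg_scale1 : left_id 1 palg_scale;
  palg_scaleDr : right_distributive palg_scale +%R;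
  palg_scaleDl : forall x, {morph palg_scale^~ x : a b / a + b};
  palg_scaleAl : forall c x y, palg_scale c (x * y) = palg_scale c x * y;
  palg_scaleAr : forall c x y, palg_scale c (x * y) = x * palg_scale c y
}.

Definition palg_sort (K : pzRingType) (A : pzAlgType K) : Type := palg_ring A.
Coercion palg_sort : pzAlgType >-> Sortclass.

HB.instance Definition _ (K : pzRingType) (A : pzAlgType K) :=
  GRing.PzRing.copy (palg_sort A) (palg_ring A).
HB.instance Definition _ (K : pzRingType) (A : pzAlgType K) :=
  GRing.Zmodule_isLmodule.Build K (palg_sort A) (@palg_scaleA K A)
    (@palg_scale1 K A) (@palg_scaleDr K A) (@palg_scaleDl K A).

Lemma pzscalerAl (K : pzRingType) (A : pzAlgType K) (c : K) (x y : A) :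
  c *: (x * y) = (c *: x) * y.
Proof. exact: palg_scaleAl. Qed.
Lemma pzscalerAr (K : pzRingType) (A : pzAlgType K) (c : K) (x y : A) :
  c *: (x * y) = x * (c *: y).
Proof. exact: palg_scaleAr. Qed.

(** ** Star structures *)

(* [cj] is the conjugation of the ground ring. *)
Definition star_structure (K : pzRingType) (cj : K -> K) (A : pzAlgType K)
    (star : A -> A) : Prop :=
  [/\ involutive star,
      forall x y, star (x + y) = star x + star y,
      forall (c : K) x, star (c *: x) = cj c *: star x
    & forall x y, star (x * y) = star y * star x].

Definition star_isomorphism (K : pzRingType) (A B : pzAlgType K)
    (starA : A -> A) (starB : B -> B) (f : A -> B) : Prop :=
  [/\ bijective f,
      forall (c : K) x y, f (c *: x + y) = c *: f x + f y,
      f 1 = 1,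
      forall x y, f (x * y) = f x * f y
    & forall x, f (starA x) = starB (f x)].

Definition star_isomorphic (K : pzRingType) (A B : pzAlgType K)
    (starA : A -> A) (starB : B -> B) : Prop :=
  exists f : A -> B, star_isomorphism starA starB f.

(** ** Formal power series *)

(* A[[hbar]], for a ring, a module or an algebra A. *)
Record fps (A : Type) := FPS { fps_coef :> nat -> A }.

HB.instance Definition _ (A : Type) := gen_eqMixin (fps A).
HB.instance Definition _ (A : Type) := gen_choiceMixin (fps A).

Lemma fpsP (A : Type) (f g : fps A) : f =1 g -> f = g.
Proof. by case: f g => [f] [g] /= /funext ->. Qed.

Definition fps_map (A B : Type) (h : A -> B) (f : fps A) : fps B :=
  FPS (fun n => h (f n)).

Section FpsZmod.
Variable V : zmodType.

Definition fps_zero : fps V := FPS (fun=> 0).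
Definition fps_opp (f : fps V) : fps V := FPS (fun n => - f n).
Definition fps_add (f g : fps V) : fps V := FPS (fun n => f n + g n).

Fact fps_addA : associative fps_add.
Proof. by move=> f g h; apply: fpsP => n /=; rewrite addrA. Qed.
Fact fps_addC : commutative fps_add.
Proof. by move=> f g; apply: fpsP => n /=; rewrite addrC. Qed.
Fact fps_add0 : left_id fps_zero fps_add.
Proof. by move=> f; apply: fpsP => n /=; rewrite add0r. Qed.
Fact fps_addN : left_inverse fps_zero fps_opp fps_add.
Proof. by move=> f; apply: fpsP => n /=; rewrite addNr. Qed.

HB.instance Definition _ := GRing.isZmodule.Build (fps V)
  fps_addA fps_addC fps_add0 fps_addN.

Lemma coef_fpsD (f g : fps V) n : (f + g) n = f n + g n. Proof. by []. Qed.
Lemma coef_fps0 n : (0 : fps V) n = 0. Proof. by []. Qed.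
Lemma coef_fpsN (f : fps V) n : (- f) n = - f n. Proof. by []. Qed.
End FpsZmod.

(* Cauchy product along a biadditive map; it gives both the multiplication of
   A[[hbar]] and the action of K[[hbar]] on V[[hbar]]. *)
Definition cauchy (U V W : zmodType) (m : U -> V -> W)
    (f : fps U) (g : fps V) : fps W :=
  FPS (fun n => \sum_(i < n.+1) m (f i) (g (n - i)%N)).

Definition biadditive (U V W : zmodType) (m : U -> V -> W) : Prop :=
  (forall x, zmod_morphism (m x)) /\ (forall y, zmod_morphism (m^~ y)).

Section CauchyTheory.

Lemma biadd0l (U V W : zmodType) (m : U -> V -> W) y :
  biadditive m -> m 0 y = 0.
Proof. by case=> _ hl; rewrite -(subrr (0 : U)) hl subrr. Qed.

Lemma biadd0r (U V W : zmodType) (m : U -> V -> W) x :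
  biadditive m -> m x 0 = 0.
Proof. by case=> hr _; rewrite -(subrr (0 : V)) hr subrr. Qed.

Lemma biaddDl (U V W : zmodType) (m : U -> V -> W) x x' y :
  biadditive m -> m (x + x') y = m x y + m x' y.
Proof.
move=> hm; have h0 := biadd0l y hm; case: hm => _ hl.
have hN z : m (- z) y = - m z y by rewrite -sub0r hl h0 sub0r.
by rewrite -[x' in LHS]opprK hl hN opprK.
Qed.

Lemma biaddDr (U V W : zmodType) (m : U -> V -> W) x y y' :
  biadditive m -> m x (y + y') = m x y + m x y'.
Proof.
move=> hm; have h0 := biadd0r x hm; case: hm => hr _.
have hN z : m x (- z) = - m x z by rewrite -sub0r hr h0 sub0r.
by rewrite -[y' in LHS]opprK hr hN opprK.
Qed.

Lemma cauchyDl (U V W : zmodType) (m : U -> V -> W) f f' g :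
  biadditive m -> cauchy m (f + f') g = cauchy m f g + cauchy m f' g.
Proof.
move=> hm; apply: fpsP => n /=; rewrite -big_split /=.
by apply: eq_bigr => i _; rewrite biaddDl.
Qed.

Lemma cauchyDr (U V W : zmodType) (m : U -> V -> W) f g g' :
  biadditive m -> cauchy m f (g + g') = cauchy m f g + cauchy m f g'.
Proof.
move=> hm; apply: fpsP => n /=; rewrite -big_split /=.
by apply: eq_bigr => i _; rewrite biaddDr.
Qed.

Lemma cauchyC (U V W : zmodType) (m : U -> V -> W) f g :
  cauchy m f g = cauchy (fun y x => m x y) g f.
Proof.
apply: fpsP => n /=; rewrite (reindex_inj rev_ord_inj) /=.
by apply: eq_bigr => i _; rewrite subSS subKn // -ltnS.
Qed.

Lemma cauchyA (U V W UV VW X : zmodType) (m12 : U -> V -> UV)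
    (m12_3 : UV -> W -> X) (m23 : V -> W -> VW) (m1_23 : U -> VW -> X) f g h :
    biadditive m12_3 -> biadditive m1_23 ->
    (forall x y z, m12_3 (m12 x y) z = m1_23 x (m23 y z)) ->
  cauchy m12_3 (cauchy m12 f g) h = cauchy m1_23 f (cauchy m23 g h).
Proof.
move=> hl hr hA.
rewrite [in LHS]cauchyC [cauchy m23 g h]cauchyC; apply: fpsP => i /=.
pose coef3 j k := m1_23 (f j) (m23 (g (i - j - k)%N) (h k)).
transitivity (\sum_(j < i.+1) \sum_(k < i.+1 | (k <= i - j)%N) coef3 j k);
  last first.
  apply: eq_bigr => /= j _.
  rewrite (big_morph _ (fun y y' => biaddDr (f j) y y' hr) (biadd0r _ hr)).
  by rewrite (big_ord_narrow_leq (leq_subr _ _)).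
rewrite (exchange_big_dep predT) //=; apply: eq_bigr => k _.
transitivity (\sum_(j < i.+1 | (j <= i - k)%N) coef3 j k); last first.
  apply: eq_bigl => j; rewrite -ltnS -(ltnS k) -!subSn ?leq_ord //.
  by rewrite -subn_gt0 -(subn_gt0 k) -!subnDA addnC.
rewrite (big_ord_narrow_leq (leq_subr _ _)).
rewrite (big_morph _ (fun x x' => biaddDl x x' (h k) hl) (biadd0l _ hl)) /=.
by apply: eq_bigr => j _; rewrite /coef3 hA -!subnDA addnC.
Qed.

End CauchyTheory.

Definition fpsC (V : zmodType) (a : V) : fps V :=
  FPS (fun n => if n is 0 then a else 0).

Lemma cauchyCl (U V W : zmodType) (m : U -> V -> W) a g : biadditive m ->
  cauchy m (fpsC a) g = fps_map (m a) g.
Proof.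
move=> hm; apply: fpsP => n /=; rewrite big_ord_recl /= subn0 big1 ?addr0 //.
by move=> i _; rewrite biadd0l.
Qed.

Section FpsRing.
Variable A : pzRingType.

Let mul_biadd : biadditive (@GRing.mul A).
Proof. by split=> x y z; rewrite ?mulrBr ?mulrBl. Qed.

Definition fps_one : fps A := fpsC 1.
Definition fps_mul (f g : fps A) : fps A := cauchy *%R f g.

Fact fps_mulA : associative fps_mul.
Proof. by move=> f g h; symmetry; apply: cauchyA => // *; rewrite mulrA. Qed.
Fact fps_mul1 : left_id fps_one fps_mul.
Proof.
by move=> f; rewrite /fps_mul cauchyCl //; apply: fpsP => n /=; rewrite mul1r.
Qed.
Fact fps_mulr1 : right_id fps_one fps_mul.
Proof.
move=> f; rewrite /fps_mul cauchyC cauchyCl.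
  by apply: fpsP => n /=; rewrite mulr1.
by split=> x y z; rewrite ?mulrBr ?mulrBl.
Qed.
Fact fps_mulDl : left_distributive fps_mul +%R.
Proof. by move=> f g h; apply: cauchyDl. Qed.
Fact fps_mulDr : right_distributive fps_mul +%R.
Proof. by move=> f g h; apply: cauchyDr. Qed.

HB.instance Definition _ := GRing.Zmodule_isPzRing.Build (fps A)
  fps_mulA fps_mul1 fps_mulr1 fps_mulDl fps_mulDr.

Lemma coef_fpsM (f g : fps A) n :
  (f * g) n = \sum_(i < n.+1) f i * g (n - i)%N.
Proof. by []. Qed.

Lemma coef_fps1 n : (1 : fps A) n = (n == 0)%:R.
Proof. by case: n. Qed.

Definition hbar : fps A := FPS (fun n => (n == 1)%:R).
End FpsRing.

Arguments hbar {A}.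

Section FpsComRing.
Variable K : comNzRingType.

Fact fps_mulC : commutative (@fps_mul K).
Proof.
move=> f g; rewrite /fps_mul cauchyC; congr (cauchy _ _ _).
by do 2!apply: funext => ?; rewrite mulrC.
Qed.
Fact fps_oner_neq0 : 1 != 0 :> fps K.
Proof.
apply/eqP => /(congr1 (fun f : fps K => f 0)) /= /eqP.
by rewrite oner_eq0.
Qed.

HB.instance Definition _ := GRing.PzSemiRing_isNonZero.Build (fps K)
  fps_oner_neq0.
HB.instance Definition _ := GRing.PzRing_hasCommutativeMul.Build (fps K)
  fps_mulC.
End FpsComRing.

Section FpsLmodule.
Variables (K : pzRingType) (V : lmodType K).

Lemma scale_biadd : biadditive (@GRing.scale K V).
Proof. by split=> x y z; rewrite ?scalerBr ?scalerBl. Qed.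

Definition fps_scale (a : fps K) (v : fps V) : fps V := cauchy *:%R a v.

Fact fps_scaleA a b v : fps_scale a (fps_scale b v) = fps_scale (a * b) v.
Proof.
symmetry; apply: cauchyA; [exact: scale_biadd|exact: scale_biadd|].
by move=> *; rewrite scalerA.
Qed.
Fact fps_scale1 : left_id 1 fps_scale.
Proof.
move=> v; rewrite /fps_scale cauchyCl; last exact: scale_biadd.
by apply: fpsP => n /=; rewrite scale1r.
Qed.
Fact fps_scaleDr : right_distributive fps_scale +%R.
Proof. by move=> a u v; apply/cauchyDr/scale_biadd. Qed.
Fact fps_scaleDl v : {morph fps_scale^~ v : a b / a + b}.
Proof. by move=> a b; apply/cauchyDl/scale_biadd. Qed.

HB.instance Definition _ := GRing.Zmodule_isLmodule.Build (fps K) (fps V)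
  fps_scaleA fps_scale1 fps_scaleDr fps_scaleDl.

Lemma coef_fpsZ (a : fps K) (v : fps V) n :
  (a *: v) n = \sum_(i < n.+1) a i *: v (n - i)%N.
Proof. by []. Qed.
End FpsLmodule.

Section FpsAlgebra.
Variables (K : pzRingType) (A : pzAlgType K).

Let mul_biadd : biadditive (@GRing.mul A).
Proof. by split=> x y z; rewrite ?mulrBr ?mulrBl. Qed.

Fact fps_scaleAl (c : fps K) (x y : fps A) : c *: (x * y) = (c *: x) * y.
Proof.
symmetry; apply: cauchyA => //; first exact: scale_biadd.
by move=> *; rewrite pzscalerAl.
Qed.
Fact fps_scaleAr (c : fps K) (x y : fps A) : c *: (x * y) = x * (c *: y).
Proof.
rewrite fps_scaleAl; change (c *: x) with (cauchy *:%R c x).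
rewrite cauchyC; apply: cauchyA => //.
by move=> a b d /=; rewrite -pzscalerAl pzscalerAr.
Qed.

Definition fps_alg : pzAlgType (fps K) :=
  @PzAlg (fps K) (fps A) *:%R
    (@scalerA (fps K) (fps A)) (@scale1r (fps K) (fps A))
    (@scalerDr (fps K) (fps A)) (fun v a b => scalerDl v a b)
    fps_scaleAl fps_scaleAr.
End FpsAlgebra.

Lemma fps_map_star (K : pzRingType) (cj : K -> K) (A : pzAlgType K)
    (star : A -> A) : star_structure cj star ->
  star_structure (fps_map cj) (A := fps_alg A) (fps_map star).
Proof.
case=> sK sD sZ sM.
have s0 : star 0 = 0 by apply: (addIr (star 0)); rewrite -sD !add0r.
split=> [f|f g|c f|f g]; apply: fpsP => n /=.
- by rewrite sK.
- by rewrite sD.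
- by rewrite (big_morph star sD s0); apply: eq_bigr => i _; rewrite sZ.
rewrite (big_morph star sD s0) (reindex_inj rev_ord_inj) /=.
by apply: eq_bigr => i _; rewrite sM subSS subKn // -ltnS.
Qed.

(** ** hbar-adic algebras *)

Definition topologically_free (K : pzRingType) (M : lmodType (fps K)) : Prop :=
  exists (V : lmodType K) (f : {linear fps V -> M}), bijective f.

(** ** The quotient A / hbar A *)

Section Reduction.
Variables (K : pzRingType) (A : pzAlgType (fps K)).

Definition hbar_ideal : {pred A} := fun x => `[< exists y, x = hbar *: y >].

Fact hbar_ideal_zmod : zmod_closed hbar_ideal.
Proof.
split; first by apply/asboolP; exists 0; rewrite scaler0.
move=> x y /asboolP[x' ->] /asboolP[y' ->]; apply/asboolP.
by exists (x' - y'); rewrite scalerBr.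
Qed.

HB.instance Definition _ := GRing.isZmodClosed.Build A hbar_ideal
  hbar_ideal_zmod.

Definition reduction : Type := Quotient.quot hbar_ideal.
HB.instance Definition _ := GRing.Zmodule.on reduction.

Definition red (x : A) : reduction := \pi_(Quotient.quot hbar_ideal) x.
Definition unred (q : reduction) : A := repr (q : Quotient.quot hbar_ideal).

Lemma unredK : cancel unred red. Proof. exact: reprK. Qed.

Lemma redP x y : red x = red y <-> exists z, x - y = hbar *: z.
Proof.
split=> [/eqP|h]; first by rewrite -Quotient.idealrBE => /asboolP.
by apply/eqP; rewrite -Quotient.idealrBE; apply/asboolP.
Qed.

Lemma redD x y : red (x + y) = red x + red y.
Proof. exact: (raddfD (\pi_(Quotient.quot hbar_ideal))). Qed.

Definition red_one : reduction := red 1.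
Definition red_mul (p q : reduction) : reduction := red (unred p * unred q).
(* K acts through the constant series. *)
Definition red_scale (c : K) (q : reduction) : reduction :=
  red (fpsC c *: unred q).
(* Independent of the representative when [f] is additive and preserves
   hbar A, as star structures do; see [red_map_star]. *)
Definition red_map (f : A -> A) (q : reduction) : reduction :=
  red (f (unred q)).

Lemma hbarC (c : fps K) : hbar * c = c * hbar.
Proof.
apply: fpsP => -[|n]; rewrite !coef_fpsM.
  by rewrite !big_ord1 mul0r mulr0.
transitivity (c n).
  by rewrite big_ord_recl mul0r add0r big_ord_recl /= mul1r subSS subn0 big1
    ?addr0 // => i _; rewrite mul0r.
rewrite big_ord_recr /= subnn mulr0 addr0 big_ord_recr /= subSnn mulr1 big1
  ?add0r // => i _.
by rewrite subSn 1?ltnW // eqSS subn_eq0 leqNgt ltn_ord mulr0.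
Qed.

Lemma redE x : exists z, unred (red x) = x + hbar *: z.
Proof.
have /redP[z hz] : red (unred (red x)) = red x by rewrite unredK.
by exists z; rewrite -hz addrCA subrr addr0.
Qed.

Lemma red_hbar x z : red (x + hbar *: z) = red x.
Proof. by apply/redP; exists z; rewrite addrAC subrr add0r. Qed.

Lemma redM x y : red_mul (red x) (red y) = red (x * y).
Proof.
rewrite /red_mul; have [z ->] := redE x; have [t ->] := redE y.
rewrite mulrDl mulrDr -pzscalerAr -pzscalerAl -addrA -scalerDr.
exact: red_hbar.
Qed.

Lemma redZ c x : red_scale c (red x) = red (fpsC c *: x).
Proof.
rewrite /red_scale; have [z ->] := redE x.
by rewrite scalerDr scalerA -hbarC -scalerA red_hbar.
Qed.

Lemma red_ind (P : reduction -> Prop) : (forall x, P (red x)) -> forall q, P q.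
Proof. by move=> h q; rewrite -[q]unredK. Qed.

Fact red_mulA : associative red_mul.
Proof.
by elim/red_ind=> x; elim/red_ind=> y; elim/red_ind=> z; rewrite !redM mulrA.
Qed.
Fact red_mul1 : left_id red_one red_mul.
Proof. by elim/red_ind=> x; rewrite redM mul1r. Qed.
Fact red_mulr1 : right_id red_one red_mul.
Proof. by elim/red_ind=> x; rewrite redM mulr1. Qed.
Fact red_mulDl : left_distributive red_mul +%R.
Proof.
elim/red_ind=> x; elim/red_ind=> y; elim/red_ind=> z.
by rewrite -redD !redM mulrDl redD.
Qed.
Fact red_mulDr : right_distributive red_mul +%R.
Proof.
elim/red_ind=> x; elim/red_ind=> y; elim/red_ind=> z.
by rewrite -redD !redM mulrDr redD.
Qed.

HB.instance Definition _ := GRing.Zmodule_isPzRing.Build reduction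
  red_mulA red_mul1 red_mulr1 red_mulDl red_mulDr.

Fact red_scaleA a b q : red_scale a (red_scale b q) = red_scale (a * b) q.
Proof.
elim/red_ind: q => x; rewrite !redZ scalerA; congr (red (_ *: _)).
rewrite [fpsC a * _]cauchyCl; last by split=> ? ? ?; rewrite ?mulrBr ?mulrBl.
by apply: fpsP => -[|n] //=; rewrite mulr0.
Qed.
Fact red_scale1 : left_id 1 red_scale.
Proof. by elim/red_ind=> x; rewrite redZ; congr red; exact: scale1r. Qed.
Fact red_scaleDr : right_distributive red_scale +%R.
Proof.
by move=> a; elim/red_ind=> x; elim/red_ind=> y;
  rewrite -redD !redZ scalerDr redD.
Qed.
Fact red_scaleDl q : {morph red_scale^~ q : a b / a + b}.
Proof.
elim/red_ind: q => x a b; rewrite !redZ -redD -scalerDl; congr (red (_ *: _)).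
by apply: fpsP => -[|n] //=; rewrite addr0.
Qed.

HB.instance Definition _ := GRing.Zmodule_isLmodule.Build K reduction
  red_scaleA red_scale1 red_scaleDr red_scaleDl.

Fact red_scaleAl (c : K) (p q : reduction) : c *: (p * q) = (c *: p) * q.
Proof.
elim/red_ind: p => x; elim/red_ind: q => y.
change (red_scale c (red_mul (red x) (red y)) =
        red_mul (red_scale c (red x)) (red y)).
by rewrite redM !redZ redM pzscalerAl.
Qed.
Fact red_scaleAr (c : K) (p q : reduction) : c *: (p * q) = p * (c *: q).
Proof.
elim/red_ind: p => x; elim/red_ind: q => y.
change (red_scale c (red_mul (red x) (red y)) =
        red_mul (red x) (red_scale c (red y))).
by rewrite redM !redZ redM pzscalerAr.
Qed.

Definition red_alg : pzAlgType K :=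
  @PzAlg K reduction *:%R
    (@scalerA K reduction) (@scale1r K reduction)
    (@scalerDr K reduction) (fun v a b => scalerDl v a b)
    red_scaleAl red_scaleAr.

End Reduction.

Lemma red_map_star (K : pzRingType) (cj : K -> K) (A : pzAlgType (fps K))
    (star : A -> A) : cj 0 = 0 -> cj 1 = 1 ->
    star_structure (fps_map cj) star ->
  (forall x, red_map star (red x) = red (star x)) /\
  star_structure cj (A := red_alg A) (red_map star).
Proof.
move=> cj0 cj1 [sK sD sZ sM].
have sh z : star (hbar *: z) = hbar *: star z.
  rewrite sZ; congr (_ *: _); apply: fpsP => -[|[|n]] /=;
  by rewrite ?mulr0n ?mulr1n ?cj0 ?cj1.
have sE x : red_map star (red x) = red (star x).
  by rewrite /red_map; have [z ->] := redE x; rewrite sD sh red_hbar.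
split=> //; split.
- by elim/red_ind=> x; rewrite !sE sK.
- by elim/red_ind=> x; elim/red_ind=> y; rewrite -redD !sE -redD sD.
- move=> c; elim/red_ind=> x.
  change (red_map star (red_scale c (red x)) =
          red_scale (cj c) (red_map star (red x))).
  rewrite redZ !sE redZ sZ; congr (red (_ *: _)).
  by apply: fpsP => -[|n] /=.
elim/red_ind=> x; elim/red_ind=> y.
change (red_map star (red_mul (red x) (red y)) =
        red_mul (red_map star (red y)) (red_map star (red x))).
by rewrite redM !sE redM sM.
Qed.

(* The star structure of an hbar-adic algebra A' descends to A' / hbar A', and
   the result is required to be isomorphic to A. *)
Definition star_deformation (K : pzRingType) (A : pzAlgType K) (star : A -> A)
    (A' : pzAlgType (fps K)) (star' : A' -> A') : Prop :=
  star_isomorphic (A := red_alg A') (red_map star') star.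

(** ** Hochschild cohomology with coefficients in the algebra itself *)

Section Hochschild.
Variables (K : pzRingType) (A : pzAlgType K).

Definition replace n (a : {ffun 'I_n -> A}) (i : 'I_n) (x : A) :
  {ffun 'I_n -> A} := [ffun j => if j == i then x else a j].

Definition multilinear n (f : {ffun 'I_n -> A} -> A) : Prop :=
  forall a i (c : K) x y,
    f (replace a i (c *: x + y)) =
    c *: f (replace a i x) + f (replace a i y).

(* (a_0, ..., a_n) |-> (a_0, ..., a_i * a_(i+1), ..., a_n); note that
   [lift ord_max j] has value j and [lift ord0 j] has value j + 1. *)
Definition contract n (a : {ffun 'I_n.+1 -> A}) (i : 'I_n) :
  {ffun 'I_n -> A} :=
  [ffun j : 'I_n => if (j < i)%N then a (lift ord_max j)
                    else if j == i then a (lift ord_max j) * a (lift ord0 j)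
                    else a (lift ord0 j)].

Definition hochschild_d n (f : {ffun 'I_n -> A} -> A)
    (a : {ffun 'I_n.+1 -> A}) : A :=
  a ord0 * f [ffun j => a (lift ord0 j)]
  + \sum_(i < n) (-1) ^+ i.+1 * f (contract a i)
  + (-1) ^+ n.+1 * (f [ffun j => a (lift ord_max j)] * a ord_max).

Definition hochschild_cocycle n (f : {ffun 'I_n -> A} -> A) : Prop :=
  multilinear f /\ forall a, hochschild_d f a = 0.

Definition hochschild_coboundary n : ({ffun 'I_n -> A} -> A) -> Prop :=
  match n with
  | 0 => fun f => forall a, f a = 0
  | m.+1 => fun f => exists g : {ffun 'I_m -> A} -> A,
              multilinear g /\ forall a, f a = hochschild_d g a
  end.

End Hochschild.

(* H^n(A, A) = 0 *)
Definition hochschild_vanishes (K : pzRingType) (A : pzAlgType K) (n : nat) :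
    Prop :=
  forall f : {ffun 'I_n -> A} -> A,
    hochschild_cocycle f -> hochschild_coboundary f.

(* Main.v *)
(** Every C-linear, star-compatible section phi of A' -> A'/hbar A' = A that is
    multiplicative modulo hbar^n (n > 0) can be corrected to one multiplicative
    modulo hbar^(n+1): the defect phi(a) phi(b) - phi(ab) is hbar^n times a map
    whose reduction is a Hochschild 2-cocycle of A. It is therefore the
    coboundary of some g, and since the cocycle is symmetric under the star, g
    may be replaced by its average with a |-> g(a^* )^*; then
    phi - hbar^n phi o g is still star-compatible. The corrections converge
    hbar-adically to a star homomorphism A -> A', and its C[[hbar]]-linear
    extension A[[hbar]] -> A' is bijective because A' is topologically free. *)
Require Import Defs.
From HB Require Import structures.
From mathcomp Require Import all_boot all_order all_algebra.
From mathcomp Require Import boolp reals complex.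

Set Implicit Arguments.
Unset Strict Implicit.
Unset Printing Implicit Defensive.

Import Order.TTheory GRing.Theory Num.Theory.
Local Open Scope ring_scope.
Local Open Scope complex_scope.

(** * Coefficients of scaled series *)

Lemma coef_hbarZ (K : pzRingType) (V : lmodType K) (v : fps V) n :
  (hbar *: v) n = if n is m.+1 then v m else 0.
Proof.
rewrite coef_fpsZ; case: n => [|n]; first by rewrite big_ord1 scale0r.
rewrite big_ord_recl scale0r add0r big_ord_recl /= scale1r subSS subn0 big1
  ?addr0 // => i _.
by rewrite scale0r.
Qed.

Lemma coef_fpsCZ (K : pzRingType) (V : lmodType K) (k : K) (v : fps V) n :
  (fpsC k *: v) n = k *: v n.
Proof.
have -> : fpsC k *: v = fps_map ( *:%R k) v by apply/cauchyCl/scale_biadd.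
by [].
Qed.

Lemma scale_fpsC (K : pzRingType) (V : lmodType K) (k : K) (v : V) :
  fpsC k *: fpsC v = fpsC (k *: v).
Proof.
by apply: fpsP => n; rewrite coef_fpsCZ; case: n => //= n; rewrite scaler0.
Qed.

Lemma fps_decomp (K : pzRingType) (V : lmodType K) (v : fps V) :
  v = fpsC (v 0) + hbar *: FPS (fun n => v n.+1).
Proof.
by apply: fpsP => n; rewrite coef_fpsD coef_hbarZ; case: n => [|n] /=;
  rewrite ?addr0 ?add0r.
Qed.

(** * Divisibility by powers of hbar *)

Definition hbar_dvd (K : pzRingType) (M : lmodType (fps K)) n (x : M) : Prop :=
  exists y, x = hbar ^+ n *: y.

Section HbarDvd.
Variables (K : pzRingType) (M : lmodType (fps K)).
Implicit Types (n : nat) (x y : M).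

Lemma hbar_dvd0 x : hbar_dvd 0 x.
Proof. by exists x; rewrite expr0 scale1r. Qed.

Lemma hbar_dvdZ n y : hbar_dvd n (hbar ^+ n *: y).
Proof. by exists y. Qed.

Lemma hbar_dvdD n x y : hbar_dvd n x -> hbar_dvd n y -> hbar_dvd n (x + y).
Proof. by move=> [u ->] [v ->]; exists (u + v); rewrite scalerDr. Qed.

Lemma hbar_dvdN n x : hbar_dvd n x -> hbar_dvd n (- x).
Proof. by move=> [u ->]; exists (- u); rewrite scalerN. Qed.

Lemma hbar_dvdB n x y : hbar_dvd n x -> hbar_dvd n y -> hbar_dvd n (x - y).
Proof. by move=> dx dy; apply: hbar_dvdD => //; apply: hbar_dvdN. Qed.

Lemma hbar_dvdW m n x : (m <= n)%N -> hbar_dvd n x -> hbar_dvd m x.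
Proof.
move=> lemn [u ->]; exists (hbar ^+ (n - m) *: u).
by rewrite scalerA -exprD subnKC.
Qed.

Lemma hbarXC n (c : fps K) : hbar ^+ n * c = c * hbar ^+ n.
Proof. by apply/commr_sym/commrX => /=; rewrite /GRing.comm hbarC. Qed.

Lemma hbar_dvdZr n (c : fps K) x : hbar_dvd n x -> hbar_dvd n (c *: x).
Proof. by move=> [u ->]; exists (c *: u); rewrite !scalerA hbarXC. Qed.

End HbarDvd.

Lemma hbar_dvdMr (K : pzRingType) (A : pzAlgType (fps K)) n (x y : A) :
  hbar_dvd n x -> hbar_dvd n (x * y).
Proof. by move=> [u ->]; exists (u * y); rewrite pzscalerAl. Qed.

Lemma hbar_dvdMl (K : pzRingType) (A : pzAlgType (fps K)) n (x y : A) :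
  hbar_dvd n y -> hbar_dvd n (x * y).
Proof. by move=> [u ->]; exists (x * u); rewrite pzscalerAr. Qed.

(** * Separation, completeness and extension principles for topologically free modules *)

Section TopologicallyFree.
Variables (K : pzRingType) (M : lmodType (fps K)).
Hypothesis hfree : topologically_free M.

Lemma tfree_coord : exists (V : lmodType K) (f : {linear fps V -> M})
  (g : {linear M -> fps V}), cancel f g /\ cancel g f.
Proof.
have [V [f [g fK gK]]] := hfree.
have gl : linear g by move=> a x y; apply: (can_inj fK); rewrite linearP !gK.
pose gL := GRing.isLinear.Build _ _ _ _ g gl.
pose g' : {linear M -> fps V} := HB.pack g gL.
by exists V, f, g'.
Qed.

Lemma hbar_scaleI (x y : M) : hbar *: x = hbar *: y -> x = y.
Proof.
have [V [f [g [_ gK]]]] := tfree_coord => h.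
apply: (can_inj gK); apply: fpsP => n.
have := congr1 (fun v => g v n.+1) h.
by rewrite !linearZ_LR !coef_hbarZ.
Qed.

Lemma hbarX_scaleI n (x y : M) : hbar ^+ n *: x = hbar ^+ n *: y -> x = y.
Proof.
elim: n x y => [|n IH] x y; first by rewrite !scale1r.
by rewrite exprSr -!scalerA => /IH /hbar_scaleI.
Qed.

(** In coordinates, divisibility by hbar^(n+1) kills coefficient n. *)
Lemma hbar_separated (x : M) : (forall n, hbar_dvd n x) -> x = 0.
Proof.
have [V [f [g [_ gK]]]] := tfree_coord => h.
apply: (can_inj gK); apply: fpsP => n; rewrite linear0.
have [y ->] := h n.+1; rewrite linearZ_LR.
elim: n {h} => [|n IH]; first by rewrite expr1 coef_hbarZ.
by rewrite exprS -scalerA coef_hbarZ IH.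
Qed.

(** Iterating gives e 0 = hbar^n e n for all n, so separation applies. It serves wherever an error
    term reproduces itself with an extra factor hbar after a shift of coefficients. *)
Lemma hbar_chain0 (e : nat -> M) : (forall n, e n = hbar *: e n.+1) -> e 0 = 0.
Proof.
move=> he; apply: hbar_separated => n; exists (e n).
elim: n => [|n ->]; first by rewrite scale1r.
by rewrite he scalerA -exprSr.
Qed.

(** [S y] is the convergent sum of the hbar^k y_k: in coordinates, coefficient n only involves the
    terms with k <= n. Later arguments use only additivity and the splitting off of the first
    term. *)
Lemma hbar_sum : exists S : (nat -> M) -> M,
  (forall y, S y = y 0 + hbar *: S (fun n => y n.+1)) /\
  (forall y z, S (fun n => y n + z n) = S y + S z).
Proof.
have [V [f [g [fK gK]]]] := tfree_coord.
exists (fun y : nat -> M =>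
  f (FPS (fun n => \sum_(k < n.+1) g (y k) (n - k)%N))).
split=> y; last first.
  move=> z; rewrite -linearD; congr (f _); apply: fpsP => n.
  rewrite coef_fpsD /= -big_split /=.
  by apply: eq_bigr => k _; rewrite linearD.
apply: (can_inj gK); rewrite linearD linearZ_LR !fK /=; apply: fpsP => n.
rewrite coef_fpsD coef_hbarZ; case: n => [|n] /=.
  by rewrite big_ord1 addr0.
by rewrite big_ord_recl; congr (_ + _).
Qed.

(** The limit is x_0 plus the sum of the increments hbar^k u_k; removing the first n increments
    leaves hbar^n times a tail sum. *)
Lemma hbar_complete (x : nat -> M) :
  (forall n, hbar_dvd n (x n.+1 - x n)) ->
  exists l, forall n, hbar_dvd n (l - x n).
Proof.
move=> /choice[u hu]; have [S [hS _]] := hbar_sum.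
exists (x 0 + S u) => n.
suff -> : x 0 + S u - x n = hbar ^+ n *: S (fun k => u (k + n)%N).
  exact: hbar_dvdZ.
elim: n => [|n IH].
  rewrite scale1r addrAC subrr add0r; congr S; apply: funext => k.
  by rewrite addn0.
rewrite -(subrK (x n) (x n.+1)) opprD addrCA IH hu hS scalerDr add0n.
rewrite addKr scalerA -exprSr; congr (_ *: S _); apply: funext => k.
by rewrite addnS.
Qed.

(* [r] keeps the constant coefficient in an identification of M with
   V[[hbar]]. *)
Lemma tfree_residue : exists r : M -> M,
  [/\ forall x y, r (x + y) = r x + r y,
      forall k x, r (fpsC k *: x) = fpsC k *: r x,
      forall x, r (hbar *: x) = 0 &
      forall x, hbar_dvd 1 (r x - x)].
Proof.
have [V [f [g [fK gK]]]] := tfree_coord.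
exists (fun x : M => f (fpsC (g x 0))); split.
- move=> x y; rewrite -linearD; congr (f _); apply: fpsP => -[|n] /=.
    by rewrite linearD.
  by rewrite addr0.
- move=> k x; rewrite -linearZ_LR scale_fpsC linearZ_LR; congr (f (fpsC _)).
  exact: coef_fpsCZ.
- move=> x; rewrite linearZ_LR coef_hbarZ -[RHS](linear0 f); congr (f _).
  by apply: fpsP => -[].
move=> x; exists (- f (FPS (fun n => g x n.+1))).
rewrite expr1 scalerN -linearZ_LR; apply/eqP.
rewrite subr_eq addrC -subr_eq opprK -linearD -fps_decomp gK.
exact/eqP.
Qed.

(** Commuting with hbar takes the place of continuity: splitting off the constant term gives T w =
    hbar T w', with w' the shifted series, and [hbar_chain0] concludes. *)
Lemma fps_ext0 (V : lmodType K) (T : fps V -> M) :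
    (forall v w, T (v + w) = T v + T w) ->
    (forall v, T (hbar *: v) = hbar *: T v) ->
    (forall a, T (fpsC a) = 0) ->
  forall v, T v = 0.
Proof.
move=> TD Th TC v.
have h w : T w = hbar *: T (FPS (fun n => w n.+1)).
  by rewrite {1}(fps_decomp w) TD TC add0r Th.
have := hbar_chain0 (e := fun n => T (FPS (fun k => v (k + n)%N))).
rewrite (_ : FPS _ = v); last by apply: fpsP => k /=; rewrite addn0.
apply=> n; rewrite h; congr (_ *: T _); apply: fpsP => k /=.
by rewrite addnS.
Qed.

Lemma fps_ext20 (V W : lmodType K) (B : fps V -> fps W -> M) :
    (forall v v' w, B (v + v') w = B v w + B v' w) ->
    (forall v w w', B v (w + w') = B v w + B v w') ->
    (forall v w, B (hbar *: v) w = hbar *: B v w) ->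
    (forall v w, B v (hbar *: w) = hbar *: B v w) ->
    (forall a b, B (fpsC a) (fpsC b) = 0) ->
  forall v w, B v w = 0.
Proof.
move=> BDl BDr Bhl Bhr BC v; apply: (fps_ext0 (BDr v) (Bhr v)) => b.
by move: v; apply: (fps_ext0 (T := B^~ (fpsC b))).
Qed.

End TopologicallyFree.

(** * Hochschild 2-cocycles as bilinear maps *)

Lemma hochschild_vanishes2P (K : pzRingType) (A : pzAlgType K) :
    hochschild_vanishes A 2 ->
  forall c : A -> A -> A,
    (forall k x y b, c (k *: x + y) b = k *: c x b + c y b) ->
    (forall k a x y, c a (k *: x + y) = k *: c a x + c a y) ->
    (forall x y z, x * c y z - c (x * y) z + c x (y * z) - c x y * z = 0) ->
  exists2 g : A -> A, forall k x y, g (k *: x + y) = k *: g x + g y &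
    forall x y, c x y = x * g y - g (x * y) + g x * y.
Proof.
move=> h2 c cl cr cc.
(* Pairs are encoded as families over ['I_2]. The differential is then evaluated by hand: signs are
   reduced by parity and the iterated [lift] indices are identified. *)
have [|g [gl gE]] := h2 (fun a => c (a ord0) (a ord_max)).
  split.
    move=> a i k x y; rewrite !ffunE.
    case: i => [[|[|//]] i]; rewrite -!val_eqE /=; [exact: cl|exact: cr].
  move=> a; rewrite /hochschild_d !big_ord_recl big_ord0 !ffunE /=.
  rewrite -!(signr_odd _ (bump _ _).+1) -!(signr_odd _ 3) /= !expr1 expr0.
  rewrite !mulN1r mul1r addr0 addrA.
  have <- : ord_max = lift ord0 ord_max :> 'I_3 by apply: val_inj.
  have -> : lift ord_max ord_max = lift ord0 ord0 :> 'I_3 by apply: val_inj.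
  have -> : lift ord_max ord0 = ord0 :> 'I_3 by apply: val_inj.
  exact: cc.
pose e (x : A) : {ffun 'I_1 -> A} := [ffun=> x].
exists (g \o e).
  move=> k x y /=.
  (* Over ['I_1] replacing the only entry yields the whole family, so multilinearity of [g] is
     linearity of [g \o e]. *)
  have re z : e z = replace (e 0) ord0 z.
    by apply/ffunP => j; rewrite !ffunE ord1.
  by rewrite re gl -!re.
move=> x y.
have := gE [ffun i : 'I_2 => if i == ord0 then x else y].
rewrite !ffunE /= => ->.
rewrite /hochschild_d !big_ord_recl big_ord0 !ffunE /=.
rewrite expr1 sqrrN expr1n mulN1r mul1r addr0.
by congr (_ * g _ - g _ + g _ * _); apply/ffunP => j; rewrite !ffunE ord1.
Qed.

(** * Star-compatible lifts of A into a deformation *)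

Section StarLift.
Variables (K : comNzRingType) (cj : K -> K) (half : K).
Hypotheses (half2 : half + half = 1) (cj_half : cj half = half).
Hypotheses (cj0 : cj 0 = 0) (cj1 : cj 1 = 1).
Variables (A : pzAlgType K) (star : A -> A).
Hypothesis hstar : star_structure cj star.
Hypothesis hH2 : hochschild_vanishes A 2.
Variables (B : pzAlgType (fps K)) (starB : B -> B).
Hypothesis hfree : topologically_free B.
Hypothesis hstarB : star_structure (fps_map cj) starB.
(** [pi] abstracts the reduction of B modulo hbar followed by the isomorphism onto A; [half] serves
    to average over the star. *)
Variable pi : B -> A.
Hypothesis pi_lin : forall k x y, pi (fpsC k *: x + y) = k *: pi x + pi y.
Hypothesis pi_mul : forall x y, pi (x * y) = pi x * pi y.
Hypothesis pi_one : pi 1 = 1.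
Hypothesis pi_star : forall x, pi (starB x) = star (pi x).
Hypothesis pi_surj : forall a, exists x, pi x = a.
Hypothesis pi_ker : forall x, pi x = 0 <-> exists y, x = hbar *: y.

Let starD x y : star (x + y) = star x + star y. Proof. by case: hstar. Qed.
Let starZ k x : star (k *: x) = cj k *: star x. Proof. by case: hstar. Qed.
Let starK : involutive star. Proof. by case: hstar. Qed.
Let starM x y : star (x * y) = star y * star x. Proof. by case: hstar. Qed.
Let starBD x y : starB (x + y) = starB x + starB y.
Proof. by case: hstarB. Qed.
Let starBZ k x : starB (k *: x) = fps_map cj k *: starB x.
Proof. by case: hstarB. Qed.
Let starBK : involutive starB. Proof. by case: hstarB. Qed.
Let starBM x y : starB (x * y) = starB y * starB x.
Proof. by case: hstarB. Qed.

Let star0 : star 0 = 0.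
Proof. by apply: (addrI (star 0)); rewrite -starD !addr0. Qed.

Let starN x : star (- x) = - star x.
Proof. by apply: (addrI (star x)); rewrite -starD !subrr star0. Qed.

Let starB0 : starB 0 = 0.
Proof. by apply: (addrI (starB 0)); rewrite -starBD !addr0. Qed.

Let starBN x : starB (- x) = - starB x.
Proof. by apply: (addrI (starB x)); rewrite -starBD !subrr starB0. Qed.

Let starBC k x : starB (fpsC k *: x) = fpsC (cj k) *: starB x.
Proof. by rewrite starBZ; congr (_ *: _); apply: fpsP => -[]. Qed.

Let starBh n x : starB (hbar ^+ n *: x) = hbar ^+ n *: starB x.
Proof.
elim: n => [|n IH]; first by rewrite !scale1r.
rewrite exprS -!scalerA starBZ IH; congr (_ *: _).
by apply: fpsP => -[|[|m]] /=; rewrite ?cj0 ?cj1.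
Qed.

Let fpsC1 : fpsC 1 = 1 :> fps K. Proof. by []. Qed.

Let piD x y : pi (x + y) = pi x + pi y.
Proof. by have := pi_lin 1 x y; rewrite fpsC1 !scale1r. Qed.

Let pi0 : pi 0 = 0.
Proof. by apply: (addrI (pi 0)); rewrite -piD !addr0. Qed.

Let piZ k x : pi (fpsC k *: x) = k *: pi x.
Proof. by have := pi_lin k x 0; rewrite pi0 !addr0. Qed.

Let piN x : pi (- x) = - pi x.
Proof. by apply: (addrI (pi x)); rewrite -piD !subrr pi0. Qed.

Let piB x y : pi (x - y) = pi x - pi y. Proof. by rewrite piD piN. Qed.

Let pi_hbar x : pi (hbar *: x) = 0. Proof. by apply/pi_ker; exists x. Qed.

Let pi_hbar_dvd n x : (0 < n)%N -> hbar_dvd n x -> pi x = 0.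
Proof. by case: n => // n _ [y ->]; rewrite exprS -scalerA pi_hbar. Qed.

Let average (x : A) : half *: (x + x) = x.
Proof. by rewrite scalerDr -scalerDl half2 scale1r. Qed.

(** The invariant of the induction: linearity, star-compatibility and the section property are
    exact, only multiplicativity is approximate. Unitality is recovered once the limit is
    multiplicative. *)
Definition star_lift n (phi : A -> B) : Prop :=
  [/\ forall k x y, phi (k *: x + y) = fpsC k *: phi x + phi y,
      forall x, phi (star x) = starB (phi x),
      forall x, pi (phi x) = x
    & forall x y, hbar_dvd n (phi x * phi y - phi (x * y))].

(** An arbitrary set-theoretic section [u] of [pi] is linear up to hbar B, which the residue [r]
    kills, so [r \o u] is a linear section. Averaging it over the star makes it star-compatible; it
    is multiplicative modulo hbar because [pi] is multiplicative with kernel hbar B. *)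
Lemma star_lift1 : exists phi, star_lift 1 phi.
Proof.
have [r [rD rZ rh r1]] := tfree_residue hfree.
have [u uK] := choice pi_surj.
have pir x : pi (r x) = pi x.
  by apply/eqP; rewrite -subr_eq0 -piB (pi_hbar_dvd _ (r1 x)).
have ruP k x y : r (u (k *: x + y)) = fpsC k *: r (u x) + r (u y).
  have /pi_ker[z] : pi (u (k *: x + y) - (fpsC k *: u x + u y)) = 0.
    by rewrite piB pi_lin !uK subrr.
  move/eqP; rewrite subr_eq => /eqP ->.
  by rewrite !rD rh add0r rZ.
pose s x := fpsC half *: (r (u x) + starB (r (u (star x)))).
exists s; split.
- move=> k x y; rewrite /s starD starZ !ruP starBD starBC.
  (* That [cj] is involutive on scalars acting on B is read off from the involution [starB]. *)
  have -> (z : B) : fpsC (cj (cj k)) *: z = fpsC k *: z.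
    by rewrite -[z]starBK -2!starBC !starBK.
  have halfC (c : fps K) : c * fpsC half = fpsC half * c by exact: fps_mulC.
  by rewrite addrACA scalerA halfC -scalerA -!scalerDr.
- by move=> x; rewrite /s starBC cj_half starK starBD starBK addrC.
- by move=> x; rewrite /s piZ piD pi_star !pir !uK starK average.
move=> x y; rewrite /hbar_dvd expr1; apply/pi_ker.
by rewrite piB pi_mul /s !piZ !piD !pi_star !pir !uK !starK !average subrr.
Qed.

Lemma star_liftS n phi : (0 < n)%N -> star_lift n phi ->
  exists phi', star_lift n.+1 phi' /\ forall x, hbar_dvd n (phi' x - phi x).
Proof.
move=> n_gt0 [phil phis phiK phiM].
have phiD x y : phi (x + y) = phi x + phi y.
  by rewrite -[x]scale1r phil fpsC1 !scale1r.
have [c cE] : exists c : A -> A -> B, forall x y,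
    phi x * phi y - phi (x * y) = hbar ^+ n *: c x y.
  exists (fun x => projT1 (choice (phiM x))) => x.
  exact: projT2 (choice (phiM x)).
(* Since hbar^n cancels, identities for [c] follow from those for the multiplicativity defect. *)
have c_uniq x y z :
    phi x * phi y - phi (x * y) = hbar ^+ n *: z -> c x y = z.
  by rewrite cE => /(hbarX_scaleI hfree).
pose cb x y := pi (c x y).
have cl k x y b : cb (k *: x + y) b = k *: cb x b + cb y b.
  rewrite /cb -pi_lin; congr pi; apply: c_uniq.
  rewrite scalerDr scalerA hbarXC -scalerA -!cE scalerBr addrACA -opprD.
  by rewrite -phil phil mulrDl mulrDl pzscalerAl pzscalerAl.
have cr k a x y : cb a (k *: x + y) = k *: cb a x + cb a y.
  rewrite /cb -pi_lin; congr pi; apply: c_uniq.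
  rewrite scalerDr scalerA hbarXC -scalerA -!cE scalerBr addrACA -opprD.
  by rewrite -phil phil mulrDr mulrDr pzscalerAr pzscalerAr.
(* With x and z written as [pi (phi x)] and [pi (phi z)], the expression is [pi] of one that already
   vanishes in B: multiplied by hbar^n, it telescopes by associativity. *)
have cocycle x y z : x * cb y z - cb (x * y) z + cb x (y * z) - cb x y * z = 0.
  rewrite -[x in x * cb y z]phiK -[z in cb x y * z]phiK /cb -!pi_mul.
  rewrite -!(piB, piD) -pi0; congr pi; apply: (hbarX_scaleI hfree (n := n)).
  rewrite scaler0 !(scalerDr, scalerN) pzscalerAr pzscalerAl -!cE.
  rewrite mulrBr mulrBl !mulrA !opprB.
  by rewrite [X in X + _]addrAC !subrKA subrr.
have cstar x y : star (cb (star y) (star x)) = cb x y.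
  rewrite /cb -pi_star; congr pi; symmetry; apply: c_uniq.
  by rewrite -starBh -cE starBD starBN starBM -starM !phis !starBK.
have [g0 g0l g0E] := hochschild_vanishes2P hH2 cl cr cocycle.
(* By [cstar] both summands have coboundary [cb], hence so does their average, which moreover
   commutes with the star. *)
pose g x := half *: (g0 x + star (g0 (star x))).
have gl k x y : g (k *: x + y) = k *: g x + g y.
  have cjcj (z : A) : cj (cj k) *: z = k *: z.
    by rewrite -[z]starK -2!starZ !starK.
  rewrite /g starD starZ !g0l starD starZ cjcj addrACA scalerA mulrC.
  by rewrite -scalerA -!scalerDr.
have gs x : g (star x) = star (g x).
  by rewrite /g starZ cj_half starK starD starK addrC.
have gE x y : cb x y = x * g y - g (x * y) + g x * y.
  rewrite -[LHS]average -{2}cstar !g0E /g !(starD, starN, starM, starK).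
  rewrite -pzscalerAr -pzscalerAl -scalerBr -scalerDr; congr (_ *: _).
  by rewrite mulrDr mulrDl opprD !addrA [LHS](ACl (1*6*2*5*3*4)).
exists (fun x => phi x - hbar ^+ n *: phi (g x)); split; last first.
  by move=> x; rewrite addrAC subrr add0r -scalerN; apply: hbar_dvdZ.
split.
- move=> k x y; rewrite gl !phil (scalerDr (hbar ^+ n)) scalerA hbarXC.
  by rewrite -scalerA opprD addrACA -scalerBr.
- by move=> x; rewrite gs !phis starBD starBN starBh.
- by move=> x; rewrite piB phiK (pi_hbar_dvd n_gt0) ?subr0 //; apply: hbar_dvdZ.
move=> x y.
set p := phi x; set q := phi y; set u := phi (g x); set v := phi (g y).
set w := phi (g (x * y)).
(* This is the coefficient of hbar^n in the defect of the corrected map; modulo hbar it is [cb]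
   minus the coboundary of [g], so it yields one more factor hbar. *)
have /pi_ker[z zE] : pi (c x y - (p * v - w + u * q)) = 0.
  rewrite !(piD, piN) !pi_mul !phiK [pi _]gE.
  by rewrite subrr.
have -> : (p - hbar ^+ n *: u) * (q - hbar ^+ n *: v)
    - (phi (x * y) - hbar ^+ n *: w)
    = hbar ^+ n *: (c x y - (p * v - w + u * q))
      + hbar ^+ n *: (hbar ^+ n *: (u * v)).
  rewrite scalerBr -cE scalerDr scalerBr mulrBl !mulrBr.
  rewrite -!pzscalerAl -!pzscalerAr.
  rewrite !opprD !opprK !addrA.
  by rewrite [RHS](ACl (1*3*5*6*2*4)).
apply: hbar_dvdD.
  by rewrite zE scalerA -exprSr; apply: hbar_dvdZ.
(* The quadratic term carries hbar^(2n), and n + 1 <= 2n because n > 0. *)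
apply: (hbar_dvdW (n := (n + n)%N)); first by rewrite -addn1 leq_add2l.
by rewrite scalerA -exprD; apply: hbar_dvdZ.
Qed.

Lemma star_lift_limit : exists phi, forall n, star_lift n phi.
Proof.
have [phi0 phi0P] := star_lift1.
have [next nextP] : exists next : nat -> (A -> B) -> (A -> B),
    forall n phi, star_lift n.+1 phi -> star_lift n.+2 (next n phi)
      /\ forall x, hbar_dvd n.+1 (next n phi x - phi x).
  suff /choice[f fP] : forall p : nat * (A -> B), exists phi',
      star_lift p.1.+1 p.2 -> star_lift p.1.+2 phi'
      /\ forall x, hbar_dvd p.1.+1 (phi' x - p.2 x).
    by exists (fun n phi => f (n, phi)) => n phi; apply: (fP (n, phi)).
  move=> [n phi] /=.
  (* Choice requires a total function; maps that are not lifts get themselves as default value. *)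
  have [/star_liftS h|h] := pselect (star_lift n.+1 phi); last by exists phi.
  by have [//|phi' ?] := h; exists phi'.
(* The term of index n is multiplicative modulo hbar^(n+1), which keeps the exponent positive as
   [star_liftS] demands. *)
pose seq_ := fix seq_ n := if n is m.+1 then next m (seq_ m) else phi0.
have seqP n : star_lift n.+1 (seq_ n).
  by elim: n => [//|n IH] /=; have [] := nextP _ _ IH.
have seq_cauchy x n : hbar_dvd n (seq_ n.+1 x - seq_ n x).
  by have [_ /(_ x)] := nextP _ _ (seqP n); apply: hbar_dvdW.
have [phi phiP] := choice (fun x => hbar_complete hfree (seq_cauchy x)).
have eq_lim (x y : B) : (forall n, hbar_dvd n (x - y)) -> x = y.
  move=> h; apply/eqP; rewrite -subr_eq0; apply/eqP.
  exact: (hbar_separated hfree).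
(* Linearity and star-compatibility hold up to hbar^m for every m, hence exactly. The section
   property needs only the term of index 1, as [pi] kills hbar B. *)
exists phi => n; split.
- move=> k x y; apply: eq_lim => m; have [phil _ _ _] := seqP m.
  have -> : phi (k *: x + y) - (fpsC k *: phi x + phi y) =
      (phi (k *: x + y) - seq_ m (k *: x + y))
      - (fpsC k *: (phi x - seq_ m x) + (phi y - seq_ m y)).
    by rewrite phil scalerBr addrACA -opprD opprB addrA subrK.
  by apply: hbar_dvdB; last apply: hbar_dvdD;
    [exact: phiP|apply: hbar_dvdZr; exact: phiP|exact: phiP].
- move=> x; apply: eq_lim => m; have [_ phis _ _] := seqP m.
  have [z zE] := phiP x m.
  have -> : phi (star x) - starB (phi x) =
      (phi (star x) - seq_ m (star x)) - starB (phi x - seq_ m x).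
    by rewrite starBD starBN -phis opprB addrA subrK.
  rewrite zE starBh; apply: hbar_dvdB; [exact: phiP|exact: hbar_dvdZ].
- move=> x; have [_ _ phiK _] := seqP 1.
  apply/eqP; rewrite -[X in _ == X]phiK -subr_eq0 -piB.
  by rewrite (pi_hbar_dvd _ (phiP x 1)).
move=> x y; have [_ _ _ phiM] := seqP n.
have -> : phi x * phi y - phi (x * y) =
    (phi x - seq_ n x) * phi y + seq_ n x * (phi y - seq_ n y)
    + (seq_ n x * seq_ n y - seq_ n (x * y))
    - (phi (x * y) - seq_ n (x * y)).
  by rewrite mulrBl mulrBr opprB !subrKA.
apply: hbar_dvdB; last exact: phiP.
apply: hbar_dvdD; last exact: hbar_dvdW (phiM x y).
by apply: hbar_dvdD; [apply: hbar_dvdMr|apply: hbar_dvdMl]; exact: phiP.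
Qed.

(** By separation [phi] is exactly multiplicative. Its extension [Phi] sums the hbar^n phi(a_n); the
    algebraic identities are checked on constants and spread to all series by [fps_ext0] and
    [fps_ext20]. Bijectivity rests on [pi \o Phi] being the constant coefficient. *)
Lemma star_lift_extend phi : (forall n, star_lift n phi) ->
  star_isomorphic (A := fps_alg A) (B := B) (fps_map star) starB.
Proof.
move=> phiP.
have [phil phis phiK _] := phiP 0.
have phiM x y : phi (x * y) = phi x * phi y.
  apply/esym/eqP; rewrite -subr_eq0; apply/eqP.
  apply: (hbar_separated hfree) => n.
  by have [_ _ _ h] := phiP n; apply: h.
have phiD x y : phi (x + y) = phi x + phi y.
  by rewrite -[x]scale1r phil fpsC1 !scale1r.
have phi0 : phi 0 = 0.
  by apply: (addrI (phi 0)); rewrite -phiD !addr0.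
have phiZ k x : phi (k *: x) = fpsC k *: phi x.
  by rewrite -[k *: x]addr0 phil phi0 addr0.
(* The element 1 - phi 1 is idempotent and lies in hbar B, so it is divisible by every power of
   hbar. *)
have phi1 : phi 1 = 1.
  have /pi_ker[y yE] : pi (1 - phi 1) = 0 by rewrite piB pi_one phiK subrr.
  apply/esym/eqP; rewrite -subr_eq0; apply/eqP.
  have idem : (1 - phi 1) * (1 - phi 1) = 1 - phi 1.
    by rewrite mulrBr mulr1 mulrBl mul1r -phiM mulr1 subrr subr0.
  apply: (hbar_separated hfree) => n; elim: n => [|n [z zE]].
    exact: hbar_dvd0.
  exists (y * z); rewrite -idem {1}yE zE -pzscalerAl -pzscalerAr scalerA.
  by rewrite -exprS.
have [S [SE SD]] := hbar_sum hfree.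
pose Phi (x : fps A) := S (fun n => phi (x n)).
have PhiE x : Phi x = phi (x 0) + hbar *: Phi (FPS (fun n => x n.+1)).
  exact: SE.
have PhiD x y : Phi (x + y) = Phi x + Phi y.
  by rewrite /Phi -SD; congr S; apply: funext => n; rewrite -phiD.
have Phi0 : Phi 0 = 0 by apply: (addrI (Phi 0)); rewrite -PhiD !addr0.
have PhiC a : Phi (fpsC a) = phi a.
  by rewrite PhiE (_ : FPS _ = 0) ?Phi0 ?scaler0 ?addr0 //; apply: fpsP.
have Phih x : Phi (hbar *: x) = hbar *: Phi x.
  rewrite PhiE coef_hbarZ phi0 add0r; congr (_ *: Phi _); apply: fpsP => n.
  exact: coef_hbarZ.
have PhiZ c x : Phi (c *: x) = c *: Phi x.
  apply/eqP; rewrite -subr_eq0; apply/eqP; move: c x.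
  (* Scalars are viewed as series over the regular module [K^o], so that the two-variable extension
     principle covers the action. *)
  apply: (fps_ext20 hfree (V := K^o) (W := A)
    (B := fun c x => Phi (c *: x) - c *: Phi x)).
  - by move=> c c' x; rewrite !scalerDl PhiD opprD addrACA.
  - by move=> c x y; rewrite PhiD !scalerDr PhiD opprD addrACA.
  - move=> c x; change (hbar *: c : fps K^o) with (hbar * c : fps K).
    by rewrite -!scalerA Phih scalerBr.
  - move=> c x; by rewrite Phih !scalerA -hbarC -!scalerA Phih scalerBr.
  by move=> k a; rewrite scale_fpsC !PhiC phiZ subrr.
have PhiM x y : Phi (x * y) = Phi x * Phi y.
  apply/eqP; rewrite -subr_eq0; apply/eqP; move: x y.
  apply: (fps_ext20 hfree (V := A) (W := A)
    (B := fun x y => Phi (x * y) - Phi x * Phi y)).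
  - by move=> x x' y; rewrite PhiD !mulrDl PhiD opprD addrACA.
  - by move=> x y y'; rewrite PhiD !mulrDr PhiD opprD addrACA.
  - by move=> x y; rewrite -fps_scaleAl !Phih -pzscalerAl scalerBr.
  - by move=> x y; rewrite -fps_scaleAr !Phih -pzscalerAr scalerBr.
  move=> a b; rewrite (_ : fpsC a * fpsC b = fpsC (a * b)).
    by rewrite !PhiC phiM subrr.
  rewrite [LHS]cauchyCl; last by split=> ? ? ?; rewrite ?mulrBr ?mulrBl.
  by apply: fpsP => -[|n] //=; rewrite mulr0.
have Phis x : Phi (fps_map star x) = starB (Phi x).
  apply/eqP; rewrite -subr_eq0; apply/eqP; move: x.
  apply: (fps_ext0 hfree (V := A)
    (T := fun x => Phi (fps_map star x) - starB (Phi x))).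
  - move=> x y; rewrite PhiD starBD (_ : fps_map star _ =
      fps_map star x + fps_map star y); first by rewrite PhiD opprD addrACA.
    by apply: fpsP => n; rewrite /= starD.
  - move=> x; rewrite Phih -{2}[hbar]expr1 starBh expr1 (_ : fps_map star _ =
      hbar *: fps_map star x); first by rewrite Phih scalerBr.
    apply: fpsP => n; transitivity (star ((hbar *: x) n)) => //.
    by rewrite !coef_hbarZ; case: n.
  move=> a; rewrite (_ : fps_map star _ = fpsC (star a)).
    by rewrite !PhiC phis subrr.
  by apply: fpsP => -[|n].
have piPhi x : pi (Phi x) = x 0.
  by rewrite PhiE piD phiK pi_hbar addr0.
have Phi_inj x : Phi x = 0 -> x = 0.
  move=> x0; apply: fpsP => n; elim: n x x0 => [|n IH] x x0.
    by rewrite -piPhi x0 pi0.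
  apply: (IH (FPS (fun n => x n.+1))); apply: (hbar_scaleI hfree).
  by rewrite scaler0 -[RHS]x0 [in RHS]PhiE -piPhi x0 pi0 phi0 add0r.
have Phi_surj y : exists x, Phi x = y.
  (* [d] strips the constant term and divides by hbar, so the n-th coefficient of the preimage is
     [pi] of the n-th iterate. The remainders [e n] below form a chain for [hbar_chain0]. *)
  have /choice[d dE] : forall z : B, exists t, z - phi (pi z) = hbar *: t.
    by move=> z; apply/pi_ker; rewrite piB phiK subrr.
  exists (FPS (fun n => pi (iter n d y))).
  apply/esym/eqP; rewrite -subr_eq0; apply/eqP.
  pose e n := iter n d y - Phi (FPS (fun k => pi (iter (k + n) d y))).
  have <- : e 0 = y - Phi (FPS (fun n => pi (iter n d y))).
    by rewrite /e; congr (_ - Phi _); apply: fpsP => n /=; rewrite addn0.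
  apply: (hbar_chain0 hfree) => n; rewrite {1}/e PhiE opprD addrA /= dE.
  rewrite -scalerBr; congr (_ *: (_ - Phi _)); apply: fpsP => k /=.
  by rewrite addnS.
have [g gK] := choice Phi_surj.
exists Phi; split=> //.
- exists g => // x; apply/eqP; rewrite -subr_eq0; apply/eqP/Phi_inj.
  have PhiN z : Phi (- z) = - Phi z.
    by apply: (addrI (Phi z)); rewrite -PhiD !subrr Phi0.
  by rewrite PhiD PhiN gK subrr.
- by move=> c x y; rewrite -PhiZ -PhiD.
- by rewrite -phi1 -PhiC.
Qed.

End StarLift.

(** * Application to the reduction of A' modulo hbar *)

Theorem proposition1 (R : realType)
    (A : pzAlgType R[i]) (star : A -> A)
    (hstar : star_structure (@conjc R) star)
    (hH1 : hochschild_vanishes A 1)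
    (hH2 : hochschild_vanishes A 2)
    (A' : pzAlgType (fps R[i])) (star' : A' -> A')
    (hfree : topologically_free A')
    (hstar' : star_structure (fps_map (@conjc R)) star')
    (hdef : star_deformation star star') :
  star_isomorphic (A := fps_alg A) (B := A') (fps_map star) star'.
Proof.
have cj0 : conjc (0 : R[i]) = 0 by exact: rmorph0.
have cj1 : conjc (1 : R[i]) = 1 by exact: rmorph1.
have half2 : 2^-1 + 2^-1 = 1 :> R[i].
  by rewrite -mulr2n -[LHS]mulr_natl divff // pnatr_eq0.
have cj_half : conjc (2^-1 : R[i]) = 2^-1 by rewrite fmorphV rmorph_nat.
have [redS _] := red_map_star cj0 cj1 hstar'.
have [theta [theta_bij theta_lin theta1 thetaM thetaS]] := hdef.
have [g thetaK gK] := theta_bij.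
have theta0 : theta 0 = 0.
  apply: (addIr (theta 0)); rewrite add0r.
  by have := theta_lin 1 0 0; rewrite !scale1r add0r => <-.
(* Injectivity of [theta] makes the kernel of this map exactly hbar A', and [redS] makes it
   star-compatible. *)
pose pi (x : A') := theta (red x).
have pi_lin k x y : pi (fpsC k *: x + y) = k *: pi x + pi y.
  by rewrite /pi redD -redZ; exact: theta_lin.
have pi_mul x y : pi (x * y) = pi x * pi y.
  by rewrite /pi -redM; exact: thetaM.
have pi_star x : pi (star' x) = star (pi x) by rewrite /pi -redS thetaS.
have pi_surj a : exists x, pi x = a.
  by exists (unred (g a)); rewrite /pi unredK gK.
have pi_ker x : pi x = 0 <-> exists y, x = hbar *: y.
  have red0 : red (0 : A') = 0 by apply: (addIr (red 0)); rewrite -redD !add0r.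
  rewrite -theta0 -red0; split=> [/(can_inj thetaK)/redP | [y xE]].
    by rewrite subr0.
  by congr theta; apply/redP; exists y; rewrite subr0.
have [phi phiP] := star_lift_limit half2 cj_half cj0 cj1 hstar hH2 hfree hstar'
  pi_lin pi_mul pi_star pi_surj pi_ker.
exact: (star_lift_extend cj0 cj1 hstar hfree hstar' pi_lin theta1 pi_ker phiP).
Qed.
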